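(* Let $(X,d)$ be a pseudometric space and let $A$ be a complete subset of $(X,d)$. Then $A$ is closed in $(X,d)$ if and only if $[a]_0\subseteq A$ holds for every $a\in A$, where $[a]_0=\{x\in X: d(a,x)=0\}$.
   Context: A pseudometric on $X$ is a nonnegative symmetric function $d:X^2\to\mathbb R$ with $d(x,x)=0$ satisfying the triangle inequality. $X$ carries the topology having the open balls $B_r(c)=\{x\in X:d(c,x)<r\}$, $r>0$, as a base. A sequence $(x_n)$ converges to $a$ if $d(x_n,a)\to 0$; Cauchy sequences are defined as in metric spaces. A subset $S\subseteq X$ is complete if every Cauchy sequence of points of $S$ converges to some point $a\in S$. *)

(* Defs.v *)
From HB Require Import structures.
From mathcomp Require Import all_boot all_order all_algebra.
From mathcomp Require Import all_classical all_reals topology normedtype.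
From mathcomp Require Import sequences.

Set Implicit Arguments.
Unset Strict Implicit.
Unset Printing Implicit Defensive.

Import Order.TTheory GRing.Theory Num.Theory.
Import numFieldNormedType.Exports.

Local Open Scope classical_set_scope.
Local Open Scope ring_scope.

Record pseudometric (R : realType) (X : Type) := Pseudometric {
  pdist :> X -> X -> R ;
  pdist_ge0 : forall x y, 0 <= pdist x y ;
  pdistC : forall x y, pdist x y = pdist y x ;
  pdistxx : forall x, pdist x x = 0 ;
  pdist_triangle : forall y x z, pdist x z <= pdist x y + pdist y z
}.

Definition open_ball (R : realType) (X : Type) (d : pseudometric R X)
  (c : X) (r : R) : set X := [set x | d c x < r].

(* [pspace d] is [X] itself; the index [d] is the key from which the topology
   induced by [d] is inferred. By [pspace_basis] below, the open balls form a
   base of that topology. *)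
Definition pspace (R : realType) (X : Type) (d : pseudometric R X) : Type := X.

Section PSpace.
Context (R : realType) (X : Type) (d : pseudometric R X).

HB.instance Definition _ := gen_eqMixin (pspace d).
HB.instance Definition _ := gen_choiceMixin (pspace d).

Let pball (c : pspace d) (r : R) : set (pspace d) := open_ball d c r.

Let ent : set_system (pspace d * pspace d) := entourage_ pball.

Let pnbhs (x : pspace d) : set_system (pspace d) := nbhs_ ent x.

Let pnbhsE : pnbhs = nbhs_ ent. Proof. by []. Qed.

HB.instance Definition _ := hasNbhs.Build (pspace d) pnbhs.

Let pball_center x (e : R) : 0 < e -> pball x e x.
Proof. by move=> e0; rewrite /pball/open_ball/= pdistxx. Qed.

Let pball_sym x y (e : R) : pball x e y -> pball y e x.
Proof. by rewrite /pball/open_ball/= pdistC. Qed.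

Let pball_triangle x y z e1 e2 :
  pball x e1 y -> pball y e2 z -> pball x (e1 + e2) z.
Proof.
rewrite /pball/open_ball/= => xy yz.
by rewrite (le_lt_trans (pdist_triangle d y _ _))// ltrD.
Qed.

Let entE : ent = entourage_ pball. Proof. by []. Qed.

HB.instance Definition _ := @Nbhs_isPseudoMetric.Build R (pspace d)
  ent pnbhsE pball pball_center pball_sym pball_triangle entE.

End PSpace.

Lemma pspace_ballE (R : realType) (X : Type) (d : pseudometric R X) (c : X)
  (r : R) : ball (c : pspace d) r = open_ball d c r.
Proof. by []. Qed.

Lemma pspace_basis (R : realType) (X : Type) (d : pseudometric R X) :
  basis [set B : set (pspace d) |
         exists c r, 0 < r /\ B = open_ball d c r].
Proof.
split=> [_ [c [r [r0 ->]]]|x V /nbhs_ballP[r /= r0 rV]].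
  rewrite openE => x /=; rewrite /open_ball/= => cxr.
  apply/nbhs_ballP; exists (r - d c x); first by rewrite /= subr_gt0.
  move=> y; rewrite pspace_ballE /open_ball/= => xy.
  by rewrite (le_lt_trans (pdist_triangle d x _ _))// -ltrBrDl.
exists (open_ball d x r); last exact: rV.
by split; [exists x, r | rewrite /open_ball/= pdistxx].
Qed.

Definition closed_in (R : realType) (X : Type) (d : pseudometric R X)
  (A : set X) : Prop := @closed (pspace d) A.

Section Sequences.
Context (R : realType) (X : Type) (d : pseudometric R X).

Definition converges_to (u : nat -> X) (a : X) : Prop :=
  (fun n => d (u n) a) @ \oo --> (0 : R).

Definition cauchy_sequence (u : nat -> X) : Prop :=
  forall e : R, 0 < e ->
    exists N : nat, forall m n, (N <= m)%N -> (N <= n)%N -> d (u m) (u n) < e.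

Definition complete_subset (S : set X) : Prop :=
  forall u : nat -> X, (forall n, S (u n)) -> cauchy_sequence u ->
    exists2 a, S a & converges_to u a.

Definition zero_class (a : X) : set X := [set x | d a x = 0].

End Sequences.

Lemma converges_toP (R : realType) (X : Type) (d : pseudometric R X)
    (u : nat -> X) (a : X) :
  converges_to d u a <-> (u : nat -> pspace d) @ \oo --> (a : pspace d).
Proof.
split=> [/cvgrPdist_lt h|/cvg_ballP h].
  apply/cvg_ballP => e e0; have := h e e0; apply: filterS => n.
  by rewrite sub0r normrN ger0_norm ?pdist_ge0// pspace_ballE /open_ball/= pdistC.
apply/cvgrPdist_lt => e e0; have := h e e0; apply: filterS => n.
by rewrite sub0r normrN ger0_norm ?pdist_ge0// pspace_ballE /open_ball/= pdistC.
Qed.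

(* Main.v *)
(** A point [x] of the closure of [A] is the limit of a sequence of points of
    [A]; this sequence is Cauchy, so by completeness it also converges to some
    [a] in [A]. Limits are unique up to distance [0], hence [x] is in [[a]_0].
    Conversely, a closed set cannot separate points at distance [0]. *)
Require Import Defs.
From mathcomp Require Import all_boot all_order all_algebra.
From mathcomp Require Import all_classical all_reals topology normedtype.
From mathcomp Require Import sequences.

Import Order.TTheory GRing.Theory Num.Theory.
Import numFieldNormedType.Exports.

Local Open Scope classical_set_scope.
Local Open Scope ring_scope.

Lemma converges_to_cauchy (R : realType) (X : Type) (d : pseudometric R X)
    (u : nat -> X) (x : X) :
  converges_to d u x -> cauchy_sequence d u.
Proof.
move=> /cvgrPdist_lt ux e e0.
have [N _ uN] := ux _ (divr_gt0 e0 (ltr0Sn R 1)).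
exists N => m n Nm Nn.
have dist_lt k : (N <= k)%N -> d (u k) x < e / 2.
  by move=> /uN /=; rewrite sub0r normrN ger0_norm ?pdist_ge0.
rewrite (le_lt_trans (pdist_triangle d x _ _))// (splitr e).
by rewrite ltrD ?dist_lt// pdistC dist_lt.
Qed.

(** By the triangle inequality through [u n], the constant [d a x] is at most
    [d (u n) a + d (u n) x] for every [n], and this sum tends to 0. *)
Lemma converges_to_zero_class (R : realType) (X : Type) (d : pseudometric R X)
    (u : nat -> X) (a x : X) :
  converges_to d u a -> converges_to d u x -> zero_class d a x.
Proof.
move=> ua ux; apply/eqP; rewrite eq_le pdist_ge0 andbT.
(* The 0 in the goal [d a x <= 0] is rewritten as the limit of the sum, so that a bound for each [n]
   suffices. *)
have /cvg_lim <- // : d (u n) a + d (u n) x @[n --> \oo] --> (0 : R).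
  by rewrite -[0](addr0 0); apply: cvgD.
apply: limr_ge; first by apply: is_cvgD; [exact: cvgP ua|exact: cvgP ux].
by apply: nearW => n; rewrite (pdistC d (u n) a) pdist_triangle.
Qed.

(** Choose [u n] in [A] within 1/(n+1) of [x]; the distances are then squeezed between 0 and
    [harmonic]. *)
Lemma closure_converges_to (R : realType) (X : Type) (d : pseudometric R X)
    (A : set X) (x : X) :
  @closure (pspace d) A x ->
  exists2 u : nat -> X, (forall n, A (u n)) & converges_to d u x.
Proof.
move=> clx.
have /choice[u u_spec] (n : nat) : exists y, A y /\ d y x < n.+1%:R^-1.
  have [|y [Ay xy]] := clx (open_ball d x n.+1%:R^-1).
    by rewrite -pspace_ballE; apply: nbhsx_ballx; rewrite invr_gt0.
  by exists y; rewrite pdistC.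
exists u => [n|]; first by have [] := u_spec n.
apply: (@squeeze_cvgr _ _ _ _ (fun=> 0) harmonic);
  [|exact: cvg_cst|exact: cvg_harmonic].
by apply: nearW => n; rewrite pdist_ge0 ltW//; have [] := u_spec n.
Qed.

Theorem proposition2p8 (R : realType) (X : Type) (d : pseudometric R X)
    (A : set X) (A_complete : complete_subset d A) :
  closed_in d A <-> (forall a : X, A a -> zero_class d a `<=` A).
Proof.
split=> [A_closed a Aa x ax0|A_zero x clx].
  (* Being at distance 0 from [x], the point [a] lies in every ball around [x], which puts [x] in
     the closure of [A]. *)
  apply: A_closed => B /nbhs_ballP[r /= r0 rB].
  by exists a; split=> //; apply: rB; rewrite pspace_ballE /open_ball/= pdistC ax0.
have [u Au ux] := closure_converges_to _ _ _ _ _ clx.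
have [a Aa ua] := A_complete u Au (converges_to_cauchy _ _ _ _ _ ux).
exact: A_zero Aa _ (converges_to_zero_class _ _ _ _ _ _ ua ux).
Qed.
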